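(* Let $\beta_1,\beta_2>0$ and $K=[-\beta_1,\beta_2]\subset\mathbb{R}$. Let $A\in\mathbb{R}^{n\times n}$ and $B\in\mathbb{R}^{n\times m}$ be constant matrices, and consider the time-invariant linear ensemble system $$\frac{d}{dt}X(t,\beta)=\beta AX(t,\beta)+BU(t),\qquad \beta\in K,$$ with $X(t,\beta)\in\mathbb{R}^n$ and piecewise continuous controls $U:[0,T]\to\mathbb{R}^m$. This system is uniformly ensemble controllable if and only if (i) $\mathrm{rank}(A)=n$, and (ii) $\mathrm{rank}(B)=n$.
   Context: $C^n(K)$ is the space of $n$-tuples of continuous real functions on $K$. Uniform ensemble controllability (on $C^n(K)$): for all $X_0,X_F\in C^n(K)$ and every $\varepsilon>0$ there exist a finite time $T>0$ (which may depend on $\varepsilon$) and a piecewise continuous control $U:[0,T]\to\mathbb{R}^m$, not depending on $\beta$, such that the solution with $X(0,\beta)=X_0(\beta)$ for all $\beta\in K$ satisfies $\sup_{\beta\in K}\|X(T,\beta)-X_F(\beta)\|<\varepsilon$. *)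

(* Defs.v *)
From HB Require Import structures.
From mathcomp Require Import all_boot all_order all_algebra.
From mathcomp Require Import all_classical all_reals all_analysis.
Set Implicit Arguments.
Unset Strict Implicit.
Unset Printing Implicit Defensive.
Import Order.TTheory GRing.Theory Num.Theory.
Import numFieldNormedType.Exports.
Local Open Scope classical_set_scope.
Local Open Scope ring_scope.

(* The library norm on matrices is the max norm, hence this definition. *)
Definition euclidean_norm (R : realType) (n : nat) (x : 'cV[R]_n) : R :=
  Num.sqrt (\sum_(i < n) x i 0 ^+ 2).

(* The space C^n(K); only the values on K are constrained. *)
Definition continuous_tuple (R : realType) (n : nat) (K : set R)
    (f : R -> 'cV[R]_n) : Prop :=
  forall i : 'I_n, {within K, continuous (fun b => f b i 0)}.

(* A function on [0, T] is represented by a function on R; all the conditions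
   are local and depend only on its restriction to [0, T]. *)
Definition piecewise_continuous (R : realType) (m : nat) (T : R)
    (U : R -> 'cV[R]_m) : Prop :=
  [/\ exists2 D : set R, finite_set D &
        forall t, 0 < t < T -> ~ D t -> {for t, continuous U},
      forall t, 0 <= t < T -> cvg (U @ t^'+) &
      forall t, 0 < t <= T -> cvg (U @ t^'-)].

(* x is the trajectory on [0, T] of x' = A x + B U: since U may jump, x is
   continuous on [0, T] and satisfies the equation wherever U is continuous. *)
Definition trajectory (R : realType) (n m : nat) (A : 'M[R]_n)
    (B : 'M[R]_(n, m)) (T : R) (U : R -> 'cV[R]_m) (x : R -> 'cV[R]_n) : Prop :=
  {within `[0, T], continuous x} /\
  forall t : R, 0 < t < T -> {for t, continuous U} ->
    is_derive t 1 x (A *m x t + B *m U t).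

(* Uniform ensemble controllability on C^n(K) of
   d/dt X(t, b) = A(b) X(t, b) + B(b) U(t), b in K.
   An extended-real supremum avoids a junk value on unbounded families. *)
Definition uniformly_ensemble_controllable (R : realType) (n m : nat)
    (K : set R) (A : R -> 'M[R]_n) (B : R -> 'M[R]_(n, m)) : Prop :=
  forall X0 XF : R -> 'cV[R]_n,
    continuous_tuple K X0 -> continuous_tuple K XF ->
  forall eps : R, 0 < eps ->
  exists (T : R) (U : R -> 'cV[R]_m) (X : R -> R -> 'cV[R]_n),
    [/\ 0 < T,
        piecewise_continuous T U,
        forall b, K b ->
          trajectory (A b) (B b) T U (X ^~ b) /\ X 0 b = X0 b &
        (ereal_sup [set (euclidean_norm (X T b - XF b))%:E | b in K]
           < eps%:E)%E].

(* Main.v *)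
Require Import Defs.
From HB Require Import structures.
From mathcomp Require Import all_boot all_order all_algebra.
From mathcomp Require Import all_classical all_reals all_analysis.
From mathcomp Require Import ring lra.
Set Implicit Arguments.
Unset Strict Implicit.
Unset Printing Implicit Defensive.
Import Order.TTheory GRing.Theory Num.Theory.
Import numFieldNormedType.Exports.
Local Open Scope classical_set_scope.
Local Open Scope ring_scope.

(** Necessity. A row vector [w] that kills the right-hand side of a linear
    equation is a conserved functional [w x]. If [w B = 0] with [w != 0], then
    at [beta = 0] the drift vanishes and [w X(., 0)] never moves, so a target
    with another value of [w X] is missed. If [w A = 0] with [w != 0], then
    [w X(., beta)] obeys the same equation [w X' = w B U] for all [beta], so
    [w (X(., beta2) - X(., 0))] never moves and the target [beta w^T] is
    missed. A trajectory satisfies its equation off a finite set only, and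
    [constant_off_finite] shows that this is enough for conservation.

    Sufficiency. Take [T = 1] and subtract the free motion
    [exp(beta A t) X0(beta)], whose value at time 1 is continuous in [beta].
    It remains to approximate any continuous function of [beta] by states
    reached from rest. The uniform limits [approx_reachable] of such states
    form a closed linear space. It contains the responses to the controls
    [(t - (1 - s))_+ u]; with [M = beta A], such a response is the series
    [sum_k M^k B u s^(k+2) / (k+2)!]. Difference quotients in [s] stay in the
    closed space, hence so do all derivatives at [s = 0], that is, the
    functions [beta^k A^k B u] ([approx_reachable_krylov]). When [A] is
    invertible and [B] has a right inverse, [A^k B u] is an arbitrary vector,
    so all polynomials in [beta] with vector coefficients are in the space,
    and by Weierstrass' theorem all continuous functions are.

    All solutions are written as exponential generating series
    [egf C s = sum_k C_k s^k / k!] of matrix sequences: differentiation in [s]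
    shifts the sequence, so that each differential equation is a recurrence
    on the coefficients. *)

(** * Entrywise norms and derivatives of matrices *)

Lemma normr_mx_le {R : realType} p q (M : 'M[R]_(p, q)) (e : R) : 0 <= e ->
  (forall i j, `|M i j| <= e) -> `|M| <= e.
Proof.
move=> e0 Me; rewrite /Num.Def.normr/= mx_normrE.
by apply: bigmax_le => // -[i j] _; exact: Me.
Qed.

Lemma normr_entry_le {R : realType} p q (M : 'M[R]_(p, q)) i j : `|M i j| <= `|M|.
Proof.
rewrite [leRHS]/Num.Def.normr/= mx_normrE.
exact: (le_bigmax _ (fun ij => `|M ij.1 ij.2|) (i, j)).
Qed.

Lemma normr_mulmx {R : realType} p q r (M : 'M[R]_(p, q)) (N : 'M[R]_(q, r)) :
  `|M *m N| <= q%:R * `|M| * `|N|.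
Proof.
apply: normr_mx_le => [|i j]; first by rewrite !mulr_ge0.
rewrite mxE (le_trans (ler_norm_sum _ _ _))//.
apply: le_trans (_ : \sum_(k < q) `|M| * `|N| <= _).
  by apply: ler_sum => k _; rewrite normrM ler_pM// normr_entry_le.
by rewrite sumr_const card_ord -mulrA mulr_natl.
Qed.

Lemma is_derive_mxP {R : realType} p q (f : R -> 'M[R]_(p, q)) (t : R) l :
  is_derive t 1 f l <-> forall i j, is_derive t 1 (fun s => f s i j) (l i j).
Proof.
split=> [[df <-] i j|fl].
  have /derivable_mxP dfij := df.
  by rewrite derive_mx// mxE; apply: derivableP.
have df : derivable f t 1 by apply/derivable_mxP => i j; case: (fl i j).
constructor => //; rewrite derive_mx//; apply/matrixP => i j; rewrite mxE.
by have [_ ->] := fl i j.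
Qed.

(** * Exponential generating series *)

Definition egf1 {R : realType} (c : nat -> R) (s : R) : R :=
  limn (pseries (fun k => c k / k`!%:R) s).

(** Comparison with the series of [K exp(a |s|)]. *)
Lemma cvgn_egf1 {R : realType} (c : nat -> R) (K a s : R) :
  0 <= K -> 0 <= a -> (forall k, `|c k| <= K * a ^+ k) ->
  cvgn (pseries (fun k => c k / k`!%:R) s) /\ `|egf1 c s| <= K * expR (a * `|s|).
Proof.
move=> K0 a0 cK.
pose u k := c k / k`!%:R * s ^+ k.
have uK k : `|u k| <= K * exp_coeff (a * `|s|) k.
  rewrite /u /exp_coeff/= !normrM normrX exprMn normfV normr_nat.
  rewrite mulrAC mulrA [K * _]mulrA.
  by rewrite ler_wpM2r ?invr_ge0// ler_wpM2r ?exprn_ge0.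
have ce : cvgn (series (fun k => K * exp_coeff (a * `|s|) k)).
  exact: is_cvg_seriesZ (is_cvg_series_exp_coeff _).
have cu : cvgn [normed series u].
  apply: (series_le_cvg _ _ uK ce) => // k.
  exact: le_trans (uK k).
split; first exact: normed_cvg cu.
apply: le_trans (lim_series_norm cu) _.
apply: le_trans (lim_series_le cu ce uK) _.
rewrite le_eqVlt; apply/orP; left; apply/eqP.
exact: lim_seriesZ (is_cvg_series_exp_coeff _).
Qed.

(** The factorial turns the coefficients [(k+1) c_(k+1) / (k+1)!] of the
    derived series into [c_(k+1) / k!]. *)
Lemma is_derive_egf1 {R : realType} (c : nat -> R) (K a s : R) :
  0 <= K -> 0 <= a -> (forall k, `|c k| <= K * a ^+ k) ->
  is_derive s 1 (egf1 c) (egf1 (fun k => c k.+1) s).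
Proof.
move=> K0 a0 cK.
have shiftE (d : nat -> R) : pseries_diffs (fun k => d k / k`!%:R) =
    (fun k => d k.+1 / k`!%:R).
  apply/funext => k; rewrite /pseries_diffs factS natrM invfM.
  by rewrite mulrCA mulVKf ?pnatr_eq0.
have cK1 k : `|c k.+1| <= K * a * a ^+ k by rewrite -mulrA -exprS.
have cK2 k : `|c k.+2| <= K * a * a * a ^+ k by rewrite -2!mulrA -!exprS mulrA.
rewrite /egf1 -shiftE; apply: (@pseries_snd_diffs _ _ (`|s| + 1)).
- by have [] := cvgn_egf1 (`|s| + 1) K0 a0 cK.
- by rewrite shiftE; have [] := cvgn_egf1 (`|s| + 1) (mulr_ge0 K0 a0) a0 cK1.
- rewrite !shiftE.
  by have [] := cvgn_egf1 (`|s| + 1) (mulr_ge0 (mulr_ge0 K0 a0) a0) a0 cK2.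
- by rewrite [ltRHS]ger0_norm ?addr_ge0// ltrDl.
Qed.

Lemma egf1_0 {R : realType} (c : nat -> R) : egf1 c 0 = c 0%N.
Proof.
apply: cvg_lim => //; rewrite -cvg_shiftS /=.
apply: cvg_near_cst; near=> k.
rewrite /pseries /series /= big_nat_recl// expr0 mulr1 fact0 divr1.
by rewrite big1 ?addr0// => i _; rewrite exprS mul0r mulr0.
Unshelve. all: by end_near. Qed.

Lemma egf1_sum {R : realType} n (c : 'I_n -> nat -> R) (b : 'I_n -> R)
    (K a s : R) : 0 <= K -> 0 <= a ->
  (forall r k, `|c r k| <= K * a ^+ k) ->
  egf1 (fun k => \sum_r b r * c r k) s = \sum_r b r * egf1 (c r) s.
Proof.
move=> K0 a0 cK; apply: cvg_lim => //.
have -> : pseries (fun k => (\sum_r b r * c r k) / k`!%:R) s =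
    (fun N => \sum_r b r * pseries (fun k => c r k / k`!%:R) s N).
  apply/funext => N; rewrite /pseries /series/=.
  under [RHS]eq_bigr do rewrite mulr_sumr.
  rewrite exchange_big/=; apply: eq_bigr => k _.
  by rewrite !mulr_suml; apply: eq_bigr => r _; rewrite !mulrA.
apply: cvg_big => [|r _]; first exact: add_continuous.
apply: cvgM; first exact: cvg_cst.
by have [] := cvgn_egf1 s K0 a0 (cK r).
Qed.

Lemma egf1D {R : realType} (c d : nat -> R) (K a L b s : R) :
  0 <= K -> 0 <= a -> (forall k, `|c k| <= K * a ^+ k) ->
  0 <= L -> 0 <= b -> (forall k, `|d k| <= L * b ^+ k) ->
  egf1 (fun k => c k + d k) s = egf1 c s + egf1 d s.
Proof.
move=> K0 a0 cK L0 b0 dL; apply: cvg_lim => //.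
have -> : pseries (fun k => (c k + d k) / k`!%:R) s =
    pseries (fun k => c k / k`!%:R) s \+ pseries (fun k => d k / k`!%:R) s.
  apply/funext => N; rewrite /pseries /series/= -big_split/=.
  by apply: eq_bigr => k _; rewrite -!mulrDl.
have [cc _] := cvgn_egf1 s K0 a0 cK; have [cd _] := cvgn_egf1 s L0 b0 dL.
exact: cvgD.
Qed.

Lemma egf1_degree1 {R : realType} (u s : R) :
  egf1 (fun k => if k == 1%N then u else 0) s = s * u.
Proof.
apply: cvg_lim => //; rewrite -2!cvg_shiftS /=.
apply: cvg_near_cst; near=> k.
rewrite /pseries /series /mk_sequence big_nat_recl// big_nat_recl//=.
rewrite !mul0r add0r.
rewrite divr1 expr1 big1 ?addr0 1?mulrC// => i _.
by rewrite !mul0r.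
Unshelve. all: by end_near. Qed.

Definition egf {R : realType} p q (C : nat -> 'M[R]_(p, q)) (s : R) :
    'M[R]_(p, q) :=
  \matrix_(i, j) egf1 (fun k => C k i j) s.

(** Growth which makes [egf C] an entire function and is preserved by all the
    operations on sequences below. *)
Definition geometric_growth {R : realType} p q (K a : R) (C : nat -> 'M[R]_(p, q)) :=
  [/\ 0 <= K, 0 <= a & forall k, `|C k| <= K * a ^+ k].

(** [egf (advance C)] is the derivative of [egf C]. *)
Definition advance {R : realType} p q (C : nat -> 'M[R]_(p, q)) k := C k.+1.

Lemma geometric_growth_entry {R : realType} p q (K a : R)
    (C : nat -> 'M[R]_(p, q)) i j k :
  geometric_growth K a C -> `|C k i j| <= K * a ^+ k.
Proof. by case=> _ _ CK; apply: le_trans (CK k); exact: normr_entry_le. Qed.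

Lemma geometric_growth_advance {R : realType} p q (K a : R)
    (C : nat -> 'M[R]_(p, q)) :
  geometric_growth K a C -> geometric_growth (K * a) a (advance C).
Proof.
case=> K0 a0 CK; split; rewrite ?mulr_ge0// => k.
by rewrite -mulrA -exprS; exact: CK.
Qed.

Section egf_theory.
Context {R : realType} {p q : nat}.
Implicit Types (C D : nat -> 'M[R]_(p, q)) (K a s : R).

Lemma egf0 C : egf C 0 = C 0%N.
Proof. by apply/matrixP => i j; rewrite mxE egf1_0. Qed.

Lemma normr_egf C K a s : geometric_growth K a C ->
  `|egf C s| <= K * expR (a * `|s|).
Proof.
move=> CK; have [K0 a0 _] := CK.
apply: normr_mx_le => [|i j]; first by rewrite mulr_ge0 ?expR_ge0.
rewrite mxE.
have [//|_ //] := @cvgn_egf1 _ (fun k => C k i j) _ _ s K0 a0.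
by move=> k; exact: geometric_growth_entry.
Qed.

Lemma is_derive_egf C K a s : geometric_growth K a C ->
  is_derive s 1 (egf C) (egf (advance C) s).
Proof.
move=> CK; have [K0 a0 _] := CK; apply/is_derive_mxP => i j.
under eq_fun do rewrite mxE.
rewrite mxE; apply: (@is_derive_egf1 _ (fun k => C k i j) _ _ s K0 a0) => k.
exact: geometric_growth_entry.
Qed.

Lemma egfD C D K a L b s : geometric_growth K a C -> geometric_growth L b D ->
  egf (fun k => C k + D k) s = egf C s + egf D s.
Proof.
move=> CK DL; have [K0 a0 _] := CK; have [L0 b0 _] := DL.
apply/matrixP => i j; rewrite !mxE.
rewrite -(egf1D _ K0 a0 _ L0 b0).
- by congr egf1; apply/funext => k; rewrite mxE.
- by move=> k; exact: geometric_growth_entry.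
- by move=> k; exact: geometric_growth_entry.
Qed.

Lemma egf_degree1 (u : 'M[R]_(p, q)) s :
  egf (fun k => if k == 1%N then u else 0) s = s *: u.
Proof.
apply/matrixP => i j; rewrite !mxE -egf1_degree1; congr egf1.
by apply/funext => k; case: ifP => _ //; rewrite mxE.
Qed.

Lemma egf_scale C b s : egf (fun k => b ^+ k *: C k) s = egf C (b * s).
Proof.
apply/matrixP => i j; rewrite !mxE /egf1.
suff -> : pseries (fun k => (b ^+ k *: C k) i j / k`!%:R) s =
    pseries (fun k => C k i j / k`!%:R) (b * s) by [].
rewrite /pseries; congr series; apply/funext => k /=; rewrite mxE exprMn.
by rewrite [b ^+ k * _]mulrC -!mulrA; congr (_ * _); rewrite mulrCA.
Qed.

Lemma egf_mulmxl r (P : 'M[R]_(r, p)) C K a s : geometric_growth K a C ->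
  egf (fun k => P *m C k) s = P *m egf C s.
Proof.
move=> CK; have [K0 a0 _] := CK; apply/matrixP => i j; rewrite !mxE.
under eq_bigr do rewrite mxE.
rewrite -(egf1_sum (fun k => P i k) s K0 a0).
- by congr egf1; apply/funext => k; rewrite mxE.
- by move=> k l; exact: geometric_growth_entry.
Qed.

Lemma egf_mulmxr r (P : 'M[R]_(q, r)) C K a s : geometric_growth K a C ->
  egf (fun k => C k *m P) s = egf C s *m P.
Proof.
move=> CK; have [K0 a0 _] := CK; apply/matrixP => i j; rewrite !mxE.
under eq_bigr do rewrite mxE mulrC.
rewrite -(egf1_sum (fun k => P k j) s K0 a0).
- congr egf1; apply/funext => k; rewrite mxE.
  by apply: eq_bigr => l _; rewrite mulrC.
- by move=> k l; exact: geometric_growth_entry.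
Qed.

End egf_theory.

(** [egf (krylov M v) s] is [exp(s M) v]. *)
Definition krylov {R : realType} n p (M : 'M[R]_n) (v : 'M[R]_(n, p)) k :=
  iter k (mulmx M) v.

Lemma geometric_growth_krylov {R : realType} n p (M : 'M[R]_n)
    (v : 'M[R]_(n, p)) (a : R) : n%:R * `|M| <= a ->
  geometric_growth `|v| a (krylov M v).
Proof.
move=> Ma; have a0 : 0 <= a by apply: le_trans Ma; rewrite mulr_ge0.
split => //; elim=> [|k IH]; first by rewrite mulr1.
rewrite /krylov iterS (le_trans (normr_mulmx _ _))//.
rewrite exprS mulrCA ler_pM ?mulr_ge0//.
Qed.

Lemma krylovZ {R : realType} n p (M : 'M[R]_n) (v : 'M[R]_(n, p)) (b : R) k :
  krylov (b *: M) v k = b ^+ k *: krylov M v k.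
Proof.
elim: k => [|k IH]; first by rewrite scale1r.
by rewrite /krylov !iterS -/(krylov _ _ _) IH -scalemxAl -scalemxAr scalerA exprS.
Qed.

Lemma krylov_mulmxr {R : realType} n p q (M : 'M[R]_n) (v : 'M[R]_(n, p))
    (w : 'M[R]_(p, q)) k : krylov M (v *m w) k = krylov M v k *m w.
Proof.
elim: k => [//|k IH].
by rewrite /krylov !iterS -!/(krylov _ _ _) IH mulmxA.
Qed.

(** [egf (delay C)] is the primitive of [egf C] that vanishes at 0. *)
Definition delay {R : realType} p q (C : nat -> 'M[R]_(p, q)) k :=
  if k is k'.+1 then C k' else 0.

(** At index [k+1] the delayed sequence is bounded by [K a^k], which is at most
    [K a^(k+1)] because [1 <= a]. *)
Lemma geometric_growth_delay {R : realType} p q (K a : R)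
    (C : nat -> 'M[R]_(p, q)) : 1 <= a ->
  geometric_growth K a C -> geometric_growth K a (delay C).
Proof.
move=> a1 [K0 a0 CK]; split=> // -[|k] /=; first by rewrite normr0 mulr1.
by apply: le_trans (CK k) _; rewrite ler_wpM2l// exprS ler_peMl ?exprn_ge0.
Qed.

(** With [y = egf (delay (delay (krylov M v)))], whose derivative is
    [egf (delay (krylov M v))], this reads [y' = M y + s v]: [y] is the response
    from rest to a ramp. It holds coefficient by coefficient. *)
Lemma egf_delay_krylov {R : realType} n p (M : 'M[R]_n) (v : 'M[R]_(n, p)) (s : R) :
  egf (delay (krylov M v)) s =
  M *m egf (delay (delay (krylov M v))) s + s *: v.
Proof.
have gDD : geometric_growth `|v| (n%:R * `|M| + 1) (delay (delay (krylov M v))).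
  have a1 : 1 <= n%:R * `|M| + 1 by rewrite lerDr mulr_ge0.
  by do 2!apply: geometric_growth_delay => //;
    apply: geometric_growth_krylov; rewrite lerDl.
have g1 : geometric_growth `|v| 1 (fun k => if k == 1%N then v else 0).
  by split=> // k; rewrite expr1n mulr1; case: ifP => // _; rewrite normr0.
have gM : geometric_growth (n%:R * `|M| * `|v|) (n%:R * `|M| + 1)
    (fun k => M *m delay (delay (krylov M v)) k).
  have [_ a0 DD] := gDD; split=> // k.
  by rewrite (le_trans (normr_mulmx _ _))// -[leRHS]mulrA ler_wpM2l ?mulr_ge0.
rewrite -(egf_mulmxl _ _ gDD) -egf_degree1 -(egfD _ gM g1).
by congr egf; apply/funext => -[|[|k]] //=; rewrite ?mulmx0 ?add0r ?addr0.
Qed.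

(** * Differential calculus on the line *)

Lemma is_derive_within_continuous {R : realType} (V : normedModType R)
    (f f' : R -> V) (A : set R) :
  (forall t : R, is_derive t 1 f (f' t)) -> {within A, continuous f}.
Proof.
move=> df; apply: continuous_subspaceT => t.
have [dft _] := df t.
exact/differentiable_continuous/derivable1_diffP.
Qed.

(** Two uses of the mean value theorem, first for [f], then for [f']. *)
Lemma taylor_order1 {R : realType} (f f' f'' : R -> R) (s h B : R) :
  0 <= h ->
  (forall t : R, is_derive t 1 f (f' t)) -> (forall t : R, is_derive t 1 f' (f'' t)) ->
  (forall t, s <= t <= s + h -> `|f'' t| <= B) ->
  `|f (s + h) - f s - h * f' s| <= h ^+ 2 * B.
Proof.
move=> h0 df df' f''B.
have ssh : s <= s + h by rewrite lerDl.
have [x] := MVT_segment ssh (fun t _ => df t)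
  (is_derive_within_continuous (A := _) df).
rewrite in_itv/= => /andP[sx xh] ->.
have [y] := MVT_segment sx (fun t _ => df' t)
  (is_derive_within_continuous (A := _) df').
rewrite in_itv/= => /andP[sy yx] f'E.
have -> : f' x * (s + h - s) - h * f' s = h * (f'' y * (x - s)).
  by rewrite -f'E; ring.
rewrite !normrM (ger0_norm h0) expr2 -mulrA ler_wpM2l// mulrC ler_pM//.
  by rewrite ger0_norm ?subr_ge0// lerBlDl.
by rewrite f''B// sy (le_trans yx).
Qed.

(** As [f] and its derivative vanish at 0, gluing [f] to 0 at the time [c] is
    differentiable at the junction too: there the difference quotients of the
    glued function are those of [f] or 0. *)
Lemma is_derive_truncated {R : realType} (f f' : R -> R) (c t : R) :
  (forall r : R, is_derive r 1 f (f' r)) -> f 0 = 0 -> f' 0 = 0 ->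
  is_derive t 1 (fun r => if r < c then 0 else f (r - c))
    (if t < c then 0 else f' (t - c)).
Proof.
move=> df f0 f'0.
have dfc (r : R) : is_derive r 1 (fun r => f (r - c)) (f' (r - c)).
  have -> : (fun r => f (r - c)) = f \o shift (- c) by [].
  by rewrite -[f' _]mulr1; apply: is_derive1_comp; exact: is_derive_shift.
have [tc|ct|tc] := ltgtP t c.
- apply: near_eq_is_derive (is_derive_cst (0 : R) t 1).
  by near=> r; rewrite ifT//; near: r; exact: lt_nbhsl.
- apply: near_eq_is_derive (dfc t).
  near=> r; rewrite ifF//; apply/negbTE; rewrite -leNgt ltW//.
  by near: r; exact: lt_nbhsr.
- rewrite tc subrr f'0.
  have [/cvg_ex[l fl] fl0] := df 0.
  rewrite f'0 /derive (cvg_lim _ fl)// in fl0; rewrite {l}fl0 in fl.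
  set g := fun r => _.
  suff gl : h^-1 *: (g (h *: 1 + c) - g c) @[h --> 0^'] --> (0 : R).
    constructor; first by apply/cvg_ex; exists 0.
    exact: cvg_lim gl.
  apply/cvgrPdist_le => e e0.
  move/cvgrPdist_le : fl => /(_ _ e0); apply: filterS => h.
  rewrite /g /= ltxx subrr f0 !subr0 addr0 addrK !sub0r !normrN.
  by case: ifP => // _ _; rewrite scaler0 normr0 ltW.
Unshelve. all: by end_near. Qed.

(** Induction on the exceptional points: each one in [a, b] splits the
    interval in two, and continuity joins the two constants. *)
Lemma constant_off_finite {R : realType} (g : R -> R) (D : seq R) (a b : R) :
  a <= b -> {within `[a, b], continuous g} ->
  (forall t, a < t < b -> t \notin D -> is_derive t 1 g 0) -> g a = g b.
Proof.
elim: D a b => [|d D IH] a b.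
  rewrite le_eqVlt => /predU1P[->//|ab] cg dg.
  have dg' t : t \in `]a, b[ -> is_derive t 1 g ((cst 0 : R -> R) t).
    by rewrite in_itv/= => tab; apply: dg.
  have [c _] := MVT ab dg' cg.
  by rewrite /cst mul0r => /eqP; rewrite subr_eq0 => /eqP.
move=> ab cg dg.
have [/andP[ad db]|dab] := boolP (a < d < b).
  transitivity (g d); apply: IH.
  - exact: ltW.
  - apply: continuous_subspaceW cg; apply: subset_itvl.
    by rewrite bnd_simp ltW.
  - move=> t /andP[atd td] tD; apply: dg; first by rewrite atd (lt_trans td).
    by rewrite inE negb_or lt_eqF.
  - exact: ltW.
  - apply: continuous_subspaceW cg; apply: subset_itvr.
    by rewrite bnd_simp ltW.
  - move=> t /andP[atd td] tD; apply: dg; first by rewrite td (lt_trans ad).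
    by rewrite inE negb_or gt_eqF.
apply: IH => // t tab tD; apply: dg => //.
by rewrite inE negb_or tD andbT; apply: contra dab => /eqP <-.
Qed.

(** * Weierstrass' theorem on a segment *)

(** For [0 <= p.[x] <= 1], the value at [x] is the expectation of [g] at the end
    of an [N]-step walk from [j] which moves up by one with probability [p.[x]]
    at each step; for [j = 0] this is Bernstein's polynomial. The recursion on
    the first step avoids binomial coefficients. *)
Fixpoint bernstein_walk {R : realType} (p : {poly R}) (g : nat -> R) N j : {poly R} :=
  if N is N'.+1 then
    p * bernstein_walk p g N' j.+1 + (1 - p) * bernstein_walk p g N' j
  else (g j)%:P.

(** The second moment of the binomial law around [m]: squared bias plus
    variance. *)
Lemma bernstein_walk_quadratic {R : realType} (p : {poly R}) (u v m x : R) N j :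
  (bernstein_walk p (fun k => u + v * (k%:R - m) ^+ 2) N j).[x] =
  u + v * ((j%:R + N%:R * p.[x] - m) ^+ 2 + N%:R * p.[x] * (1 - p.[x])).
Proof.
elim: N j => [|N IH] j /=; first by rewrite hornerC; ring.
by rewrite !hornerE !IH -!natr1; ring.
Qed.

(** The walk is a convex combination of values of [g], so it inherits any
    bound on their distance to [c]. *)
Lemma bernstein_walk_dist {R : realType} (p : {poly R}) (g h : nat -> R) (c x : R) N j :
  0 <= p.[x] <= 1 -> (forall k, (k <= j + N)%N -> `|g k - c| <= h k) ->
  `|(bernstein_walk p g N j).[x] - c| <= (bernstein_walk p h N j).[x].
Proof.
move=> /andP[p0 p1]; elim: N j => [|N IH] j gh /=.
  by rewrite !hornerC gh// addn0.
rewrite !hornerE.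
have -> : forall A B : R, p.[x] * A + (1 - p.[x]) * B - c =
  p.[x] * (A - c) + (1 - p.[x]) * (B - c) by move=> A B; ring.
rewrite (le_trans (ler_normD _ _))// !normrM.
rewrite (ger0_norm p0) (@ger0_norm _ (1 - _)) ?subr_ge0//.
by apply: lerD; apply: ler_wpM2l; rewrite ?subr_ge0//; apply: IH => k kN; apply: gh;
  rewrite ?addnS -?addSn// (leq_trans kN)// leq_add2l.
Qed.

(** Compactness makes the moduli of continuity at the points uniform. *)
Lemma heine_segment {R : realType} (f : R -> R) (a b e : R) : 0 < e ->
  {within `[a, b], continuous f} ->
  exists2 d, 0 < d & forall x y, x \in `[a, b] -> y \in `[a, b] ->
    `|x - y| < d -> `|f x - f y| <= e.
Proof.
move=> e0 /subspace_continuousP cf.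
pose modulus d x := forall y, y \in `[a, b] -> `|x - y| < d -> `|f x - f y| <= e.
have : \forall d \near 0^'+, [set` `[a, b]] `<=` modulus d.
  have /compact_near_coveringP/near_covering_withinP := @segment_compact R a b.
  apply => x0 x0ab.
  have /cvgrPdist_lt /(_ _ (divr_gt0 e0 (ltr0n _ 2))) := cf _ x0ab.
  move=> /nbhs_ballP[r /= r0 rf].
  near=> x' d => x'ab y yab x'y.
  have h z : z \in `[a, b] -> `|x0 - z| < r -> `|f x0 - f z| < e / 2.
    by move=> zab zr; apply: rf.
  have x'r : `|x0 - x'| < r / 2.
    by near: x'; apply: nbhsx_ballx; rewrite divr_gt0.
  have dr : d < r / 2 by near: d; apply: nbhs_right_lt; rewrite divr_gt0.
  have /(h _ x'ab) fx' : `|x0 - x'| < r.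
    by rewrite (lt_le_trans x'r)// ler_pdivrMr// ler_peMr ?ler1n// ltW.
  have /(h _ yab) fy : `|x0 - y| < r.
    by rewrite (le_lt_trans (ler_distD x' _ _))// (splitr r) ltrD// (lt_trans x'y).
  rewrite (le_trans (ler_distD (f x0) _ _))// (splitr e) lerD ?ltW//.
  by rewrite distrC.
move=> fd; near ((0 : R)^'+) => d; exists d => // x y xab.
by apply: (near fd d).
Unshelve. all: by end_near. Qed.

(** The distance of [f] at a node to [f x] is at most [e / 2] for close nodes and
    at most [2 M] for the others, hence at most [e / 2] plus a multiple of the
    squared distance of the node to [x]. In mean, this square is of order
    [1 / N]. *)
Lemma weierstrass_approximation {R : realType} (f : R -> R) (a b e : R) :
  a < b -> 0 < e -> {within `[a, b], continuous f} ->
  exists p : {poly R}, forall x, x \in `[a, b] -> `|f x - p.[x]| <= e.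
Proof.
move=> ab e0 cf.
have e20 : 0 < e / 2 by rewrite divr_gt0.
have [d d0 fd] := heine_segment e20 cf.
have [M M0 fM] : exists2 M, 0 < M & forall x, x \in `[a, b] -> `|f x| <= M.
  have cNf : {within `[a, b], continuous (fun x => - f x)}.
    by move=> x; apply: cvgN; exact: cf.
  have [x1 _ fx1] := EVT_max (ltW ab) cf.
  have [x2 _ fx2] := EVT_max (ltW ab) cNf.
  exists (1 + `|f x1| + `|f x2|); first by rewrite !ltr_wpDr.
  move=> x xab; have := fx1 _ xab; have := fx2 _ xab.
  have := ler_norm (f x1); have := ler_norm (- f x2); rewrite normrN.
  have := normr_ge0 (f x1); have := normr_ge0 (f x2).
  by rewrite ler_norml => *; apply/andP; split; lra.
have ba0 : 0 < b - a by rewrite subr_gt0.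
pose L := 2 * M / d ^+ 2 * (b - a) ^+ 2.
have L0 : 0 < L by rewrite mulr_gt0 ?exprn_gt0 ?divr_gt0 ?exprn_gt0 ?mulr_gt0.
pose N := (Num.truncn (L / (e / 2))).+1.
have NL : L / N%:R <= e / 2.
  rewrite ler_pdivrMr ?ltr0n// mulrC -ler_pdivrMr// ltW//.
  exact: truncnS_gt.
have N0 : N%:R != 0 :> R by rewrite pnatr_eq0.
pose p : {poly R} := (b - a)^-1 *: ('X - a%:P).
pose node k : R := a + (b - a) * k%:R / N%:R.
exists (bernstein_walk p (fun k => f (node k)) N 0) => x xab.
have pE : p.[x] = (x - a) / (b - a) by rewrite !hornerE mulrC.
have p01 : 0 <= p.[x] <= 1.
  move: xab; rewrite in_itv/= pE => /andP[ax xb].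
  apply/andP; split; first by rewrite divr_ge0 ?subr_ge0// ltW.
  by rewrite ler_pdivrMr// mul1r lerB.
(* [v] turns the squared distance counted in steps, [(k - N p.[x])^2], into
   [2 M / d^2] times the squared distance of the node to [x]. *)
pose v := L / N%:R ^+ 2.
rewrite distrC (le_trans (bernstein_walk_dist
  (h := fun k => e / 2 + v * (k%:R - N%:R * p.[x]) ^+ 2) p01 _))//.
  move=> k; rewrite add0n => kN.
  have kab : node k \in `[a, b].
    rewrite in_itv/= /node lerDl divr_ge0 ?mulr_ge0 ?(ltW ba0)//=.
    rewrite -lerBrDl -mulrA ger_pMr// ler_pdivrMr ?ltr0n// mul1r ler_nat//.
  have vE : v * (k%:R - N%:R * p.[x]) ^+ 2 = 2 * M / d ^+ 2 * (node k - x) ^+ 2.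
    have -> : node k - x = (b - a) * (k%:R - N%:R * p.[x]) / N%:R.
      rewrite pE /node; field.
      by rewrite N0 gt_eqF.
    by rewrite /v /L; field; rewrite N0 gt_eqF.
  have [near_|far] := ltP `|node k - x| d.
    rewrite (le_trans (fd _ _ kab xab near_))// lerDl vE.
    by rewrite mulr_ge0 ?sqr_ge0// divr_ge0 ?sqr_ge0// mulr_ge0// ltW.
  apply: le_trans (_ : 2 * M <= _).
    by rewrite (le_trans (ler_normB _ _))// mulr_natl mulr2n lerD// fM.
  rewrite vE (ler_wpDl (ltW e20))// mulrAC ler_pdivlMr ?exprn_gt0//.
  rewrite ler_pM2l ?mulr_gt0// -(real_normK (num_real (node k - x))).
  by rewrite lerXn2r// nnegrE// ltW.
rewrite bernstein_walk_quadratic add0r subrr expr0n add0r.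
rewrite [leRHS]splitr lerD2l.
apply: le_trans NL.
have -> : v * (N%:R * p.[x] * (1 - p.[x])) = L / N%:R * (p.[x] * (1 - p.[x])).
  by rewrite /v; field.
move/andP: p01 => [p0 p1].
rewrite ger_pMr ?divr_gt0 ?ltr0n// mulr_ile1 ?subr_ge0// lerBlDr lerDl//.
Qed.

(** * Uniform limits of states reachable from rest *)

Section approx_reachable.
Context {R : realType} {n m : nat} (A : 'M[R]_n) (B : 'M[R]_(n, m)) (K : set R).
Implicit Types (f g : R -> 'cV[R]_n) (C : R -> nat -> 'cV[R]_n).

(** Continuous controls, with the equation at all times, make sums of controls
    harmless: the jumps of two discontinuous controls may cancel, and the sum
    would then have to satisfy the equation at a time where neither of the two
    trajectories is known to satisfy its own. *)
Definition approx_reachable f := forall e : R, 0 < e ->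
  exists (U : R -> 'cV[R]_m) (X : R -> R -> 'cV[R]_n),
  [/\ continuous U,
      forall b, K b -> X 0 b = 0 /\
        forall t : R, is_derive t 1 (X ^~ b) ((b *: A) *m X t b + B *m U t) &
      forall b, K b -> `|X 1 b - f b| <= e].

Lemma approx_reachable_closed f :
  (forall e : R, 0 < e -> exists2 g, approx_reachable g &
     forall b, K b -> `|g b - f b| <= e) ->
  approx_reachable f.
Proof.
move=> fg e e0; have e20 : 0 < e / 2 by rewrite divr_gt0.
have [g /(_ _ e20)[U [X [cU dX Xg]]] gf] := fg _ e20.
exists U, X; split=> // b Kb.
by rewrite (le_trans (ler_distD (g b) _ _))// (splitr e) lerD ?Xg ?gf.
Qed.

Lemma approx_reachable_eq f g : (forall b, K b -> f b = g b) ->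
  approx_reachable f -> approx_reachable g.
Proof.
move=> fg rf; apply: approx_reachable_closed => e e0.
by exists f => // b Kb; rewrite fg// subrr normr0 ltW.
Qed.

Lemma approx_reachable0 : approx_reachable (fun=> 0).
Proof.
move=> e e0; exists (cst 0), (fun _ _ => 0); split.
- by move=> x; exact: cvg_cst.
- move=> b _; split=> // t; rewrite !mulmx0 addr0.
  exact: (is_derive_cst (0 : 'cV[R]_n)).
- by move=> b _; rewrite subrr normr0 ltW.
Qed.

Lemma approx_reachableD f g : approx_reachable f -> approx_reachable g ->
  approx_reachable (fun b => f b + g b).
Proof.
move=> rf rg e e0; have e20 : 0 < e / 2 by rewrite divr_gt0.
have [U [X [cU dX Xf]]] := rf _ e20; have [V [Y [cV dY Yg]]] := rg _ e20.
exists (fun t => U t + V t), (fun t b => X t b + Y t b); split.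
- by move=> t; apply: cvgD; [exact: cU|exact: cV].
- move=> b Kb; have [X0 dXb] := dX _ Kb; have [Y0 dYb] := dY _ Kb.
  split=> [|t]; first by rewrite X0 Y0 addr0.
  rewrite !mulmxDr addrACA.
  exact: (is_deriveD (f := X ^~ b) (g := Y ^~ b)).
- move=> b Kb; rewrite opprD addrACA (le_trans (ler_normD _ _))//.
  by rewrite (splitr e) lerD ?Xf ?Yg.
Qed.

Lemma approx_reachableZ (c : R) f : approx_reachable f ->
  approx_reachable (fun b => c *: f b).
Proof.
move=> rf e e0.
have [|U [X [cU dX Xf]]] := rf (e / (`|c| + 1)).
  by rewrite divr_gt0// ltr_wpDl.
exists (fun t => c *: U t), (fun t b => c *: X t b); split.
- by move=> t; apply: cvgZ; [exact: cvg_cst|exact: cU].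
- move=> b Kb; have [X0 dXb] := dX _ Kb.
  split=> [|t]; first by rewrite X0 scaler0.
  rewrite -!scalemxAr -scalerDr.
  exact: (is_deriveZ (f := X ^~ b)).
- move=> b Kb; rewrite -scalerBr normrZ.
  apply: le_trans (_ : (`|c| + 1) * (e / (`|c| + 1)) <= e).
    by rewrite ler_pM// ?Xf// lerDl.
  by rewrite mulrC divfK// gt_eqF// ltr_wpDl.
Qed.

Definition uniform_geometric_growth C :=
  exists k a, forall b, K b -> geometric_growth k a (C b).

(** The difference quotients of [egf (C b)] at [s] are in the closed linear
    space, and they tend to [egf (advance (C b)) s] uniformly in [b] since the
    second derivatives have a common bound on [0, 1]. *)
Lemma approx_reachable_advance C : uniform_geometric_growth C ->
  (forall s, 0 <= s < 1 -> approx_reachable (fun b => egf (C b) s)) ->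
  forall s, 0 <= s < 1 -> approx_reachable (fun b => egf (advance (C b)) s).
Proof.
move=> [k [a Cka]] rC s /andP[s0 s1].
apply: approx_reachable_closed => e e0.
have [[b0 Kb0]|K0] := pselect (exists b, K b); last first.
  exists (fun=> 0); first exact: approx_reachable0.
  by move=> b Kb; case: K0; exists b.
have [k0 a0 _] := Cka _ Kb0.
(* [L] bounds the second derivatives on [0, 1]; the first bound on [h] keeps
   [s + h] below 1, the second one makes the error [h L] at most [e]. *)
pose L := k * a * a * expR a.
have L0 : 0 <= L by rewrite !mulr_ge0// expR_ge0.
pose h := Num.min ((1 - s) / 2) (e / (L + 1)).
have h0 : 0 < h.
  by rewrite lt_min !divr_gt0 ?subr_gt0// ltr_wpDl.
have hs : s + h < 1.
  by rewrite -ltrBrDl gt_min; apply/orP; left; lra.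
have hL : h * L <= e.
  apply: le_trans (_ : e / (L + 1) * (L + 1) <= _); last first.
    by rewrite divfK// gt_eqF// ltr_wpDl.
  by rewrite ler_pM// ?(ltW h0) ?lerDl// ge_min lexx orbT.
exists (fun b => h^-1 *: (egf (C b) (s + h) + (-1) *: egf (C b) s)).
  apply: approx_reachableZ; apply: approx_reachableD.
    by apply: rC; rewrite hs addr_ge0// ltW.
  by apply: approx_reachableZ; apply: rC; rewrite s0.
move=> b Kb.
have gC := Cka _ Kb; have gC1 := geometric_growth_advance gC.
have gC2 := geometric_growth_advance gC1.
apply: normr_mx_le => [|i j]; first exact: ltW.
rewrite -(ler_pM2l h0) -[X in X * `|_|](ger0_norm (ltW h0)) -normrM.
have -> : h * (h^-1 *: (egf (C b) (s + h) + -1 *: egf (C b) s) -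
     egf (advance (C b)) s) i j =
   egf (C b) (s + h) i j - egf (C b) s i j - h * egf (advance (C b)) s i j.
  by rewrite !mxE; field; rewrite gt_eqF.
apply: le_trans (_ : h ^+ 2 * L <= _); last first.
  by rewrite expr2 -mulrA ler_wpM2l// ltW.
apply: (@taylor_order1 _ (fun t => egf (C b) t i j)
  (fun t => egf (advance (C b)) t i j)
  (fun t => egf (advance (advance (C b))) t i j)) => [|t|t|t /andP[st tsh]].
- exact: ltW.
- by have /is_derive_mxP := is_derive_egf t gC; apply.
- by have /is_derive_mxP := is_derive_egf t gC1; apply.
- rewrite (le_trans (normr_entry_le _ _ _))// (le_trans (normr_egf _ gC2))//.
  rewrite ler_wpM2l ?mulr_ge0// ler_expR ler_piMr//.
  by rewrite ger0_norm ?(le_trans s0)// (le_trans tsh)// ltW.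
Qed.

Lemma uniform_geometric_growth_advance C :
  uniform_geometric_growth C -> uniform_geometric_growth (fun b => advance (C b)).
Proof.
move=> [k [a Ck]]; exists (k * a), a => b Kb.
exact/geometric_growth_advance/Ck.
Qed.

(** [C b k] is the [k]-th derivative of [egf (C b)] at 0. *)
Lemma approx_reachable_coef C : uniform_geometric_growth C ->
  (forall s, 0 <= s < 1 -> approx_reachable (fun b => egf (C b) s)) ->
  forall k, approx_reachable (fun b => C b k).
Proof.
move=> gC rC k; elim: k => [|k IH] in C gC rC *.
  have := rC 0; rewrite lexx ltr01 => /(_ isT); apply: approx_reachable_eq.
  by move=> b _; rewrite egf0.
apply: (IH (fun b => advance (C b))) (uniform_geometric_growth_advance gC) _.
exact: approx_reachable_advance.
Qed.

(** The ratio of the growth is increased by 1 in order to be at least 1, as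
    delayed sequences require. *)
Lemma uniform_geometric_growth_krylov (v : 'cV[R]_n) (r : R) :
  (forall b, K b -> `|b| <= r) ->
  uniform_geometric_growth (fun b => delay (delay (krylov (b *: A) v))).
Proof.
move=> Kr; exists `|v|, (n%:R * (`|r| * `|A|) + 1) => b Kb.
have a1 : 1 <= n%:R * (`|r| * `|A|) + 1 by rewrite lerDr !mulr_ge0.
do 2!apply: geometric_growth_delay => //.
apply: geometric_growth_krylov; rewrite ler_wpDr// normrZ ler_wpM2l//.
by rewrite ler_wpM2r// (le_trans (Kr _ Kb))// ler_norm.
Qed.

(** The control is a ramp which starts at time [1 - s], so that it has acted
    during time [s] when the state is observed. A ramp is used rather than a step
    because it keeps the control continuous and the trajectory differentiable. *)
Lemma approx_reachable_ramp (u : 'cV[R]_m) r s :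
  (forall b, K b -> `|b| <= r) -> 0 <= s < 1 ->
  approx_reachable (fun b => egf (delay (delay (krylov (b *: A) (B *m u)))) s).
Proof.
move=> Kr /andP[s0 s1] e e0.
pose c := 1 - s; pose D b := delay (krylov (b *: A) (B *m u)).
exists (fun t => Num.max (t - c) 0 *: u).
exists (fun t b => if t < c then 0 else egf (delay (D b)) (t - c)); split.
- move=> t; apply: cvgZ; last exact: cvg_cst.
  apply: (@continuous_max R R (fun t => t - c) (cst 0)); last exact: cvg_cst.
  by apply: cvgB; [exact: cvg_id|exact: cvg_cst].
- move=> b Kb; split=> [|t]; first by rewrite /c subr_gt0 s1.
  have [k [a /(_ _ Kb) gDD]] := uniform_geometric_growth_krylov (B *m u) Kr.
  apply/is_derive_mxP => i j.
  have -> : (fun t0 => (if t0 < c then 0 else egf (delay (D b)) (t0 - c)) i j) =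
      (fun t0 => if t0 < c then 0 else egf (delay (D b)) (t0 - c) i j).
    by apply/funext => t0; case: ifP => // _; rewrite mxE.
  have -> : ((b *: A) *m (if t < c then 0 else egf (delay (D b)) (t - c)) +
      B *m (Num.max (t - c) 0 *: u)) i j =
      if t < c then 0 else egf (D b) (t - c) i j.
    rewrite -scalemxAr egf_delay_krylov /Num.max subr_lt0.
    by case: ifP => // _; rewrite mulmx0 scale0r addr0 mxE.
  apply: (@is_derive_truncated _ (fun t => egf (delay (D b)) t i j)
    (fun t => egf (D b) t i j)) => [t0||].
  + by have /is_derive_mxP := is_derive_egf t0 gDD; apply.
  + by rewrite egf0 mxE.
  + by rewrite egf0 mxE.
- move=> b _; rewrite ltNge gerBl s0/= /c subKr.
  by rewrite subrr normr0 ltW.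
Qed.

(** The two delays of a ramp response put the [k]-th term of the Krylov sequence at
    index [k + 2]. *)
Lemma approx_reachable_krylov (u : 'cV[R]_m) r k : (forall b, K b -> `|b| <= r) ->
  approx_reachable (fun b => b ^+ k *: krylov A (B *m u) k).
Proof.
move=> Kr.
have rD s := @approx_reachable_ramp u r s Kr.
have := approx_reachable_coef (uniform_geometric_growth_krylov (B *m u) Kr) rD k.+2.
by apply: approx_reachable_eq => b _ /=; rewrite krylovZ.
Qed.

End approx_reachable.

(** * Sufficiency of the rank conditions *)

Lemma approx_reachable_sum {R : realType} n m (A : 'M[R]_n) (B : 'M[R]_(n, m))
    (K : set R) (I : Type) (r : seq I) (F : I -> R -> 'cV[R]_n) :
  (forall i, approx_reachable A B K (F i)) ->
  approx_reachable A B K (fun b => \sum_(i <- r) F i b).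
Proof.
move=> rF; elim: r => [|i r IH].
  by apply: approx_reachable_eq (approx_reachable0 _ _ _) => b _; rewrite big_nil.
apply: approx_reachable_eq (approx_reachableD (rF i) IH) => b _.
by rewrite big_cons.
Qed.

(** Hence an invertible drift can bring the [k]-th Krylov vector anywhere. *)
Lemma krylov_invmx {R : realType} n p (A : 'M[R]_n) (w : 'M[R]_(n, p)) k :
  A \in unitmx -> krylov A (krylov (invmx A) w k) k = w.
Proof.
move=> Au; elim: k => [//|k IH].
by rewrite /krylov iterSr iterS mulKVmx.
Qed.

(** Monomials [x^k w] are reached by the choice [B u = A^-k w], then polynomials
    by linearity, then continuous coordinates by Weierstrass' theorem. *)
Lemma approx_reachable_continuous {R : realType} n m (A : 'M[R]_n)
    (B : 'M[R]_(n, m)) (a b : R) (f : R -> 'cV[R]_n) :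
  a < b -> \rank A = n -> \rank B = n -> continuous_tuple `[a, b] f ->
  approx_reachable A B `[a, b] f.
Proof.
move=> ab rA rB cf.
have Au : A \in unitmx by rewrite -row_full_unit /row_full rA.
have Bf : row_free B by rewrite /row_free rB.
have Kr x : `[a, b]%classic x -> `|x| <= `|a| + `|b|.
  rewrite /= in_itv/= => /andP[ax xb]; rewrite ler_norml.
  have := ler_norm (- a); have := ler_norm b; rewrite normrN.
  have := normr_ge0 a; have := normr_ge0 b.
  by move=> *; apply/andP; split; lra.
have monomial k (w : 'cV[R]_n) : approx_reachable A B `[a, b] (fun x => x ^+ k *: w).
  have := approx_reachable_krylov A B (pinvmx B *m krylov (invmx A) w k) k Kr.
  by rewrite mulmxA mulmxVp// mul1mx krylov_invmx.
have poly (p : {poly R}) (w : 'cV[R]_n) :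
    approx_reachable A B `[a, b] (fun x => p.[x] *: w).
  have h (i : 'I_(size p)) := approx_reachableZ p`_i (monomial i w).
  apply: approx_reachable_eq (approx_reachable_sum (index_enum _) h) => x _.
  by rewrite horner_coef scaler_suml; apply: eq_bigr => i _; rewrite scalerA.
have coord i : approx_reachable A B `[a, b] (fun x => f x i 0 *: delta_mx i 0).
  apply: approx_reachable_closed => e e0.
  have [p fp] := weierstrass_approximation ab e0 (cf i).
  exists (fun x => p.[x] *: delta_mx i 0); first exact: poly.
  move=> x xab; rewrite -scalerBl normrZ distrC.
  rewrite -[leRHS]mulr1 ler_pM ?fp//.
  by apply: normr_mx_le => // k l; rewrite mxE; case: (_ && _); rewrite ?normr1 ?normr0.
apply: approx_reachable_eq (approx_reachable_sum (index_enum _) coord) => x _.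
apply/matrixP => i j; rewrite summxE (bigD1 i)//= big1 => [|k ki].
  by rewrite !mxE eqxx ord1 eqxx mulr1 addr0.
by rewrite !mxE eq_sym (negbTE ki) mulr0.
Qed.

Lemma euclidean_norm_le {R : realType} n (x : 'cV[R]_n) :
  euclidean_norm x <= n.+1%:R * `|x|.
Proof.
rewrite -[leRHS]ger0_norm ?mulr_ge0// -sqrtr_sqr ler_wsqrtr//.
apply: le_trans (_ : n%:R * `|x| ^+ 2 <= _).
  rewrite mulr_natl -[X in _ *+ X]card_ord -sumr_const; apply: ler_sum => i _.
  by rewrite -(real_normK (num_real (x i 0))) lerXn2r ?nnegrE// normr_entry_le.
rewrite exprMn ler_wpM2r ?sqr_ge0// -natrX ler_nat.
by rewrite (leq_trans (leqnSn n))// leq_pmulr.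
Qed.

Lemma normr_entry_euclidean {R : realType} n (x : 'cV[R]_n) i :
  `|x i 0| <= euclidean_norm x.
Proof.
rewrite -sqrtr_sqr ler_wsqrtr// (bigD1 i)//= lerDl sumr_ge0// => j _.
exact: sqr_ge0.
Qed.

(** The trajectory is the free motion [H] plus a motion from rest aimed at the
    target minus [H 1]. *)
Lemma controllable_of_full_rank {R : realType} n m (A : 'M[R]_n)
    (B : 'M[R]_(n, m)) (a b : R) :
  a < b -> \rank A = n -> \rank B = n ->
  uniformly_ensemble_controllable `[a, b] (fun x => x *: A) (fun=> B).
Proof.
move=> ab rA rB X0 XF cX0 cXF eps eps0.
pose H t x := egf (krylov (x *: A) (X0 x)) t.
have gH x : geometric_growth `|X0 x| (n%:R * `|x *: A|) (krylov (x *: A) (X0 x)).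
  exact: geometric_growth_krylov.
have gA : geometric_growth `|1%:M : 'M[R]_n| (n%:R * `|A|) (krylov A 1%:M).
  exact: geometric_growth_krylov.
(* The entries of [exp(x A)] are power series in [x], which gives the
   continuity of the free motion at time 1 in the parameter. *)
have H1E x : H 1 x = egf (krylov A 1%:M) x *m X0 x.
  rewrite -(egf_mulmxr _ _ gA) -[X in _ = egf _ X]mulr1 -egf_scale; congr egf.
  by apply/funext => k; rewrite krylovZ -krylov_mulmxr mul1mx.
have cG : continuous_tuple `[a, b] (fun x => XF x - H 1 x).
  move=> i.
  have -> : (fun x => (XF x - H 1 x) i 0) = (fun x => XF x i 0 -
      \sum_j egf (krylov A 1%:M) x i j * X0 x j 0).
    by apply/funext => x; rewrite H1E !mxE.
  move=> x; apply: cvgB; first exact: cXF.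
  apply: cvg_big => [|j _]; first exact: add_continuous.
  apply: cvgM; last exact: cX0.
  apply: (is_derive_within_continuous
    (f' := fun x => egf (advance (krylov A 1%:M)) x i j)) => t.
  by have /is_derive_mxP := is_derive_egf t gA; apply.
pose d := eps / 2 / n.+1%:R.
have d0 : 0 < d by rewrite !divr_gt0.
have [U [Z [cU dZ Zd]]] := approx_reachable_continuous ab rA rB cG d0.
exists 1, U, (fun t x => H t x + Z t x); split=> //.
- split=> [|t _|t _].
  + by exists set0 => // t _ _; exact: cU.
  + by apply/cvg_ex; exists (U t); apply: cvg_at_right_filter; exact: cU.
  + by apply/cvg_ex; exists (U t); apply: cvg_at_left_filter; exact: cU.
- move=> x xab; have [Z0 dZx] := dZ _ xab.
  have dX (t : R) : is_derive t 1 (fun t => H t x + Z t x)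
      (x *: A *m (H t x + Z t x) + B *m U t).
    rewrite mulmxDr -addrA -(egf_mulmxl _ _ (gH x)).
    exact: (is_deriveD (f := H ^~ x) (g := Z ^~ x)
      (df := _) (is_derive_egf t (gH x)) (dZx t)).
  split; last by rewrite Z0 addr0 /H egf0.
  by split=> [|t _ _]; [exact: is_derive_within_continuous dX|exact: dX].
- apply: le_lt_trans (_ : ((eps / 2)%:E < eps%:E)%E); last first.
    by rewrite lte_fin ltr_pdivrMr// ltr_pMr// ltr1n.
  apply: ge_ereal_sup => _ [x xab <-]; rewrite lee_fin.
  rewrite (le_trans (euclidean_norm_le _))//.
  rewrite mulrC -ler_pdivlMr// -/d.
  by have := Zd _ xab; rewrite opprB addrCA addrA.
Qed.

(** * Necessity of the rank conditions *)

(** The scalar function [w x] is continuous and its derivative [w l] vanishes off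
    a finite set. *)
Lemma conserved_functional {R : realType} n (w : 'rV[R]_n) (T : R) (D : set R)
    (x l : R -> 'cV[R]_n) :
  0 <= T -> finite_set D -> {within `[0, T], continuous x} ->
  (forall t, 0 < t < T -> ~ D t -> is_derive t 1 x (l t) /\ w *m l t = 0) ->
  w *m x T = w *m x 0.
Proof.
move=> T0 /finite_seqP[s ->] cx dx.
apply/matrixP => i j; rewrite !ord1 {i j} !mxE; apply/esym.
apply: (@constant_off_finite _ (fun t => \sum_j w 0 j * x t j 0) s) => //.
  move=> t; apply: cvg_big => [|j _]; first exact: add_continuous.
  apply: cvgM; first exact: cvg_cst.
  exact: (cvg_comp _ _ (cx t) (@coord_continuous _ _ _ j 0 (x t))).
move=> t tT /negP ts; have [/is_derive_mxP dxt wl] := dx _ tT ts.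
have -> : (fun t => \sum_j w 0 j * x t j 0) =
    \sum_j (w 0 j *: (fun t => x t j 0 : R)).
  by apply/funext => r; rewrite fct_sumE.
have <- : \sum_j w 0 j *: l t j 0 = 0.
  by have := congr1 (fun M : 'M[R]_1 => M 0 0) wl; rewrite !mxE.
by apply: is_derive_sum => j; apply: is_deriveZ.
Qed.

Lemma normr_functional_euclidean {R : realType} n (w : 'rV[R]_n)
    (y : 'cV[R]_n) (e : R) : euclidean_norm y <= e ->
  `|(w *m y) 0 0| <= (\sum_j `|w 0 j|) * e.
Proof.
move=> ye; rewrite mxE (le_trans (ler_norm_sum _ _ _))// mulr_suml.
apply: ler_sum => j _; rewrite normrM ler_wpM2l//.
exact: le_trans (normr_entry_euclidean _ _) ye.
Qed.

Lemma left_kernel_vector {R : realType} n p (M : 'M[R]_(n, p)) :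
  \rank M <> n -> exists2 w : 'rV[R]_n, w *m M = 0 & 0 < (w *m w^T) 0 0.
Proof.
move=> /eqP; rewrite -/(row_free M) -kermx_eq0 => /rowV0Pn[w /sub_kermxP wM w0].
exists w => //; rewrite mxE.
have w2 j : 0 <= w 0 j * w^T j 0 by rewrite mxE -expr2 sqr_ge0.
rewrite lt_neqAle sumr_ge0 ?andbT//; apply: contra w0 => /eqP/esym/psumr_eq0P w20.
apply/eqP/rowP => j; rewrite mxE; apply/eqP.
by have /eqP := w20 (fun j _ => w2 j) j isT; rewrite mxE -expr2 sqrf_eq0.
Qed.

Lemma controllable_from_rest {R : realType} n m (K : set R) (A : R -> 'M[R]_n)
    (B : R -> 'M[R]_(n, m)) (XF : R -> 'cV[R]_n) (eps : R) :
  uniformly_ensemble_controllable K A B -> continuous_tuple K XF -> 0 < eps ->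
  exists T U (X : R -> R -> 'cV[R]_n), [/\ 0 < T,
    exists2 D : set R, finite_set D &
      forall t, 0 < t < T -> ~ D t -> {for t, continuous U},
    forall b, K b -> trajectory (A b) (B b) T U (X ^~ b),
    forall b, K b -> X 0 b = 0 &
    forall b, K b -> euclidean_norm (X T b - XF b) <= eps].
Proof.
move=> uec cXF eps0.
have c0 : continuous_tuple K (fun=> 0 : 'cV[R]_n).
  by move=> i x; exact: cvg_cst.
have [T [U [X [T0 [UD _ _] tX Xeps]]]] := uec _ _ c0 cXF _ eps0.
exists T, U, X; split=> // b Kb; try by have [] := tX _ Kb.
rewrite -lee_fin ltW// (le_lt_trans _ Xeps)//.
by apply: ereal_sup_ubound; exists b.
Qed.

(** At a parameter with [A b = 0], a vector [w] with [w B = 0] gives the conserved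
    functional [w X]; from rest it stays 0 and misses the value [w w^T > 0]. *)
Lemma full_rank_input_of_controllable {R : realType} n m (K : set R)
    (A : R -> 'M[R]_n) (B : 'M[R]_(n, m)) (b : R) : K b -> A b = 0 ->
  uniformly_ensemble_controllable K A (fun=> B) -> \rank B = n.
Proof.
move=> Kb Ab0 uec; apply: contrapT => /left_kernel_vector[w wB w0].
pose S := \sum_j `|w 0 j|; have S0 : 0 <= S by rewrite sumr_ge0.
pose eps := (w *m w^T) 0 0 / (S + 1).
have eps0 : 0 < eps by rewrite divr_gt0// ltr_wpDl.
have cw : continuous_tuple K (fun=> w^T) by move=> i x; exact: cvg_cst.
have [T [U [X [T0 [D fD UD] tX X0 Xw]]]] := controllable_from_rest uec cw eps0.
have [cX dX] := tX _ Kb.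
have : w *m X T b = w *m X 0 b.
  apply: (conserved_functional (x := X ^~ b) (ltW T0) fD cX) => t tT Dt.
  split; first by apply: dX => //; exact: UD.
  by rewrite Ab0 mul0mx add0r mulmxA wB mul0mx.
rewrite X0// mulmx0 => wX.
have := normr_functional_euclidean w (Xw _ Kb).
rewrite mulmxBr wX sub0r mxE normrN gtr0_norm// leNgt -/S => /negP; apply.
rewrite /eps mulrCA gtr_pMr// ltr_pdivrMr ?mul1r ?ltrDl//.
by rewrite ltr_wpDl.
Qed.

(** If [w A = 0], the input term of the equation of [w X] does not depend on the
    parameter and cancels in [w (X(., b) - X(., 0))]. From rest this difference
    stays 0, while the target [x w^T] asks for [b w w^T > 0]. *)
Lemma full_rank_drift_of_controllable {R : realType} n m (K : set R)
    (A : 'M[R]_n) (B : 'M[R]_(n, m)) (b : R) : K 0 -> K b -> 0 < b ->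
  uniformly_ensemble_controllable K (fun x => x *: A) (fun=> B) -> \rank A = n.
Proof.
move=> K0 Kb b0 uec; apply: contrapT => /left_kernel_vector[w wA w0].
pose S := \sum_j `|w 0 j|; have S0 : 0 <= S by rewrite sumr_ge0.
(* The two terminal errors contribute at most [2 S eps < b w w^T]. *)
pose eps := b * (w *m w^T) 0 0 / (2 * S + 1).
have S1 : 0 < 2 * S + 1 by rewrite ltr_wpDl// mulr_ge0.
have eps0 : 0 < eps by rewrite divr_gt0// mulr_gt0.
have cw : continuous_tuple K (fun x => x *: w^T).
  move=> i; under eq_fun do rewrite mxE.
  apply: continuous_subspaceT => x.
  by apply: cvgM; [exact: cvg_id|exact: cvg_cst].
have [T [U [X [T0 [D fD UD] tX X0 Xw]]]] := controllable_from_rest uec cw eps0.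
have [cXb dXb] := tX _ Kb; have [cX0 dX0] := tX _ K0.
have : w *m (X T b - X T 0) = w *m (X 0 b - X 0 0).
  apply: (conserved_functional (x := fun t => X t b - X t 0)
    (l := fun t => (b *: A *m X t b + B *m U t) - (0 *: A *m X t 0 + B *m U t))
    (ltW T0) fD).
    by move=> t; apply: cvgB; [exact: cXb|exact: cX0].
  move=> t tT Dt; split.
    exact: (is_deriveB (f := X ^~ b) (g := X ^~ 0)
      (dXb _ tT (UD _ tT Dt)) (dX0 _ tT (UD _ tT Dt))).
  by rewrite scale0r mul0mx add0r addrK mulmxA -scalemxAr wA scaler0 mul0mx.
rewrite !X0// subrr mulmx0 => wX.
have := normr_functional_euclidean w (Xw _ Kb).
have := normr_functional_euclidean w (Xw _ K0).
rewrite -/S scale0r subr0 mulmxBr -scalemxAr => w1 w2.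
have : b * (w *m w^T) 0 0 <= 2 * (S * eps).
  have -> : b * (w *m w^T) 0 0 =
     (w *m X T 0) 0 0 - (w *m X T b - b *: (w *m w^T)) 0 0.
    have /(congr1 (fun M : 'M[R]_1 => M 0 0)) := wX.
    by rewrite mulmxBr !mxE => h; lra.
  rewrite (le_trans (ler_norm _))// (le_trans (ler_normB _ _))//.
  by rewrite mulr_natl mulr2n lerD.
rewrite leNgt => /negP; apply.
rewrite mulrA /eps mulrCA gtr_pMr ?mulr_gt0// ltr_pdivrMr// mul1r.
by rewrite ltrDl.
Qed.

Theorem theorem1 (R : realType) (n m : nat) (beta1 beta2 : R)
    (hbeta1 : 0 < beta1) (hbeta2 : 0 < beta2)
    (A : 'M[R]_n) (B : 'M[R]_(n, m)) :
  uniformly_ensemble_controllable `[- beta1, beta2]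
    (fun beta => beta *: A) (fun _ => B)
  <-> \rank A = n /\ \rank B = n.
Proof.
have K0 : `[- beta1, beta2]%classic 0.
  by rewrite /= in_itv/= oppr_le0 !ltW.
have Kb : `[- beta1, beta2]%classic beta2.
  by rewrite /= in_itv/= lexx andbT (le_trans _ (ltW hbeta2))// oppr_le0 ltW.
split=> [uec|[rA rB]].
  split; first exact: full_rank_drift_of_controllable K0 Kb hbeta2 uec.
  exact: full_rank_input_of_controllable K0 (scale0r _) uec.
apply: controllable_of_full_rank => //.
by rewrite (lt_trans _ hbeta2)// oppr_lt0.
Qed.
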